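(* There is a monad $\mathbb O$ on the category $\mathrm{GS}$ of graphical species (in $\mathsf{Set}$) such that the category $\mathrm{CA}$ of circuit algebras (in $\mathsf{Set}$) is equivalent to the Eilenberg-Moore category $\mathrm{GS}^{\mathbb O}$ of algebras for $\mathbb O$.
   Context: Notation: $\mathbf n=\{1,\dots,n\}$, $\mathbf 0=\emptyset$; $\sigma_{\mathbf 2}$ is the non-identity permutation of $\mathbf 2$. Graphical species. Let $\mathbf B$ be the groupoid of finite sets and bijections. The category $\mathbf B^{\S}$ is obtained from $\mathbf B$ by adjoining one object $\S$ with: $\mathbf B^{\S}(\S,\S)=\{\mathrm{id},\tau\}\cong\mathbb Z/2$; for every finite set $X$, $\mathbf B^{\S}(\S,X)=\{ch_x,\ ch_x\circ\tau\}_{x\in X}\cong X\amalg X$; $\mathbf B^{\S}(X,Y)=\mathbf B(X,Y)$; $\mathbf B^{\S}(X,\S)=\emptyset$; and $f\circ ch_x=ch_{f(x)}$ for every bijection $f:X\to Y$. A graphical species is a functor $S:(\mathbf B^{\S})^{\mathrm{op}}\to\mathsf{Set}$, with values written $S_{\S}$ (with involution $S_\tau$) and $S_X$. $\mathrm{GS}$ is the category of graphical species and natural transformations. Contraction. For distinct $x,y\in X$ let $S_X^{x\ddagger y}=\{a\in S_X: S(ch_x)(a)=S(ch_y\circ\tau)(a)\}$; for several disjoint pairs, impose all the conditions. A contraction $\zeta$ on $S$ is a family of maps $\zeta_X^{x\ddagger y}=\zeta_X^{y\ddagger x}:S_X^{x\ddagger y}\to S_{X\setminus\{x,y\}}$ (for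 each finite set $X$ and distinct $x,y\in X$) that is equivariant for the action of $\mathbf B^{\S}$: if $\sigma:X\to Z$ is a bijection with $\sigma(x)=w,\sigma(y)=z$ and restriction $\hat\sigma:X\setminus\{x,y\}\to Z\setminus\{w,z\}$, then $S(\hat\sigma)\circ\zeta_Z^{w\ddagger z}=\zeta_X^{x\ddagger y}\circ S(\sigma)$; and $S(ch_v)\circ\zeta_X^{x\ddagger y}=S(ch_v)$ for $v\in X\setminus\{x,y\}$. External product. An external product $\boxtimes$ on $S$ is a family of maps $\boxtimes_{X,Y}:S_X\times S_Y\to S_{X\amalg Y}$, equivariant for bijections of $X$ and $Y$, commutative ($\boxtimes_{Y,X}=\boxtimes_{X,Y}\circ(\text{swap})$) and such that $S(ch_x^{X\amalg Y})\circ\boxtimes_{X,Y}=S(ch_x^X)\circ\mathrm{pr}_{S_X}$ for all $x\in X$; it is equipped with an external unit $0_S\in S_{\mathbf 0}$ such that $a\boxtimes 0_S=a$ for all $a\in S_X$. A nonunital circuit algebra is a graphical species $S$ with an external product $\boxtimes$ and a contraction $\zeta$ such that: (C1) $\boxtimes$ is associative; (C2) contractions commute: $\zeta_{X\setminus\{w,x\}}^{y\ddagger z}\circ\zeta_X^{w\ddagger x}=\zeta_{X\setminus\{y,z\}}^{w\ddagger x}\circ\zeta_X^{y\ddagger z}$ on $S_X^{w\ddagger x,y\ddagger z}$ for distinct $w,x,y,z\in X$; (C3) $\zeta_{X\amalg Y}^{x_1\ddagger x_2}\circ\boxtimes_{X,Y}=\boxtimes_{X\setminus\{x_1,x_2\},Y}\circ(\zeta_X^{x_1\ddagger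 x_2}\times\mathrm{id})$ on $S_X^{x_1\ddagger x_2}\times S_Y$ for distinct $x_1,x_2\in X$. A (unital) circuit algebra is a nonunital circuit algebra together with a unit-like map $\epsilon:S_{\S}\to S_{\mathbf 2}$, i.e. $\epsilon\circ S_\tau=S(\sigma_{\mathbf 2})\circ\epsilon$ and $S(ch_1)\circ\epsilon=\mathrm{id}$, such that for all finite $X$, $x\in X$ and $a\in S_X$: $\zeta_{X\amalg\mathbf 2}^{x\ddagger 2}\big(a\boxtimes\epsilon(S(ch_x)(a))\big)=a$ under the canonical isomorphism $(X\setminus\{x\})\amalg\{1\}\cong X$. Morphisms of circuit algebras are morphisms of graphical species preserving $\boxtimes$ (with its external unit), $\zeta$ and $\epsilon$; the category is denoted $\mathrm{CA}$. *)

(* Defs.v *)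
From mathcomp Require Import all_boot.
From mathcomp Require Import boolp.

Set Implicit Arguments.
Unset Strict Implicit.
Unset Printing Implicit Defensive.

#[local] Obligation Tactic := idtac.

(* Sets are modelled by types.  Morphisms are compared with Leibniz equality;
   functional extensionality and proof irrelevance (boolp) make this the usual
   equality of functions, natural transformations, etc. *)

Record Category := {
  obj :> Type;
  hom : obj -> obj -> Type;
  idm : forall a, hom a a;
  comp : forall a b c, hom b c -> hom a b -> hom a c;
  comp1m : forall a b (f : hom a b), comp (idm b) f = f;
  compm1 : forall a b (f : hom a b), comp f (idm a) = f;
  compA : forall a b c d (h : hom c d) (g : hom b c) (f : hom a b),
    comp h (comp g f) = comp (comp h g) f }.

Arguments idm {_} _.

Declare Scope cat_scope.
Delimit Scope cat_scope with cat.
Local Open Scope cat_scope.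
Notation "g 'o' f" := (comp g f) (at level 40, left associativity) : cat_scope.

Definition opposite (C : Category) : Category := {|
  obj := C;
  hom := fun a b => hom b a;
  idm := fun a => idm a;
  comp := fun a b c g f => f o g;
  comp1m := fun a b f => compm1 f;
  compm1 := fun a b f => comp1m f;
  compA := fun a b c d h g f => esym (compA f g h) |}.

Definition SET : Category := {|
  obj := Type;
  hom := fun A B => A -> B;
  idm := fun A => id;
  comp := fun A B C g f x => g (f x);
  comp1m := fun A B f => erefl;
  compm1 := fun A B f => erefl;
  compA := fun A B C D h g f => erefl |}.

Record Functor (C D : Category) := {
  fobj :> C -> D;
  fmap : forall a b, hom a b -> hom (fobj a) (fobj b);
  fmap1 : forall a, fmap (idm a) = idm (fobj a);
  fmapM : forall a b c (g : hom b c) (f : hom a b),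
    fmap (g o f) = fmap g o fmap f }.

Definition idF (C : Category) : Functor C C := {|
  fobj := fun a => a;
  fmap := fun a b f => f;
  fmap1 := fun a => erefl;
  fmapM := fun a b c g f => erefl |}.

Program Definition compF (C D E : Category) (G : Functor D E) (F : Functor C D) :
    Functor C E := {|
  fobj := fun a => G (F a);
  fmap := fun a b f => fmap G (fmap F f) |}.
Next Obligation. by move=> C D E G F a; rewrite /= !fmap1. Qed.
Next Obligation. by move=> C D E G F a b c g f; rewrite /= !fmapM. Qed.

Record NatTrans (C D : Category) (F G : Functor C D) := {
  ntc :> forall a, hom (F a) (G a);
  ntN : forall a b (f : hom a b), ntc b o fmap F f = fmap G f o ntc a }.

Lemma nat_eq (C D : Category) (F G : Functor C D) (s t : NatTrans F G) :
  (forall a, s a = t a) -> s = t.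
Proof.
case: s t => [s sN] [t tN] /= st.
have est : s = t by apply: functional_extensionality_dep.
by subst t; congr Build_NatTrans; exact: Prop_irrelevance.
Qed.

Program Definition id_nat (C D : Category) (F : Functor C D) : NatTrans F F :=
  {| ntc := fun a => idm (F a) |}.
Next Obligation. by move=> C D F a b f; rewrite comp1m compm1. Qed.

Program Definition comp_nat (C D : Category) (F G H : Functor C D)
    (t : NatTrans G H) (s : NatTrans F G) : NatTrans F H :=
  {| ntc := fun a => t a o s a |}.
Next Obligation.
by move=> C D F G H t s a b f; rewrite -compA ntN compA ntN compA.
Qed.

Program Definition functor_cat (C D : Category) : Category := {|
  obj := Functor C D;
  hom := fun F G => NatTrans F G;
  idm := fun F => id_nat F;
  comp := fun F G H t s => comp_nat t s |}.
Next Obligation. by move=> C D F G s; apply: nat_eq => a; exact: comp1m. Qed.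
Next Obligation. by move=> C D F G s; apply: nat_eq => a; exact: compm1. Qed.
Next Obligation.
by move=> C D F G H K u t s; apply: nat_eq => a; exact: compA.
Qed.

Definition is_iso (C : Category) (a b : C) (f : hom a b) : Prop :=
  exists g : hom b a, g o f = idm a /\ f o g = idm b.

Definition natural_iso (C D : Category) (F G : Functor C D) : Prop :=
  exists t : NatTrans F G, forall a, is_iso (t a).

Definition equivalent (C D : Category) : Prop :=
  exists (F : Functor C D) (G : Functor D C),
    natural_iso (idF C) (compF G F) /\ natural_iso (compF F G) (idF D).

Record Monad (C : Category) := {
  mfun :> Functor C C;
  munit : NatTrans (idF C) mfun;
  mmul : NatTrans (compF mfun mfun) mfun;
  mmul_unitl : forall a, mmul a o munit (mfun a) = idm (mfun a);
  mmul_unitr : forall a, mmul a o fmap mfun (munit a) = idm (mfun a);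
  mmulA : forall a, mmul a o fmap mfun (mmul a) = mmul a o mmul (mfun a) }.

Record Algebra (C : Category) (T : Monad C) := {
  alg_carrier :> C;
  alg_act : hom (T alg_carrier) alg_carrier;
  alg_unit : alg_act o munit T alg_carrier = idm alg_carrier;
  alg_mul : alg_act o fmap T alg_act = alg_act o mmul T alg_carrier }.

Record AlgebraMor (C : Category) (T : Monad C) (A B : Algebra T) := {
  alg_mor :> hom (alg_carrier A) (alg_carrier B);
  alg_morP : alg_mor o alg_act A = alg_act B o fmap T alg_mor }.

Lemma alg_mor_eq (C : Category) (T : Monad C) (A B : Algebra T)
  (f g : AlgebraMor A B) : alg_mor f = alg_mor g -> f = g.
Proof.
case: f g => [f fP] [g gP] /= fg; subst g.
by congr Build_AlgebraMor; exact: Prop_irrelevance.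
Qed.

Program Definition id_alg (C : Category) (T : Monad C) (A : Algebra T) :
  AlgebraMor A A := {| alg_mor := idm (alg_carrier A) |}.
Next Obligation. by move=> C T A; rewrite fmap1 comp1m compm1. Qed.

Program Definition comp_alg (C : Category) (T : Monad C) (A B D : Algebra T)
    (g : AlgebraMor B D) (f : AlgebraMor A B) : AlgebraMor A D :=
  {| alg_mor := alg_mor g o alg_mor f |}.
Next Obligation.
by move=> C T A B D g f; rewrite -compA alg_morP compA alg_morP fmapM compA.
Qed.

Program Definition EilenbergMoore (C : Category) (T : Monad C) : Category := {|
  obj := Algebra T;
  hom := fun A B => AlgebraMor A B;
  idm := fun A => id_alg A;
  comp := fun A B D g f => comp_alg g f |}.
Next Obligation. by move=> C T A B f; apply: alg_mor_eq; exact: comp1m. Qed.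
Next Obligation. by move=> C T A B f; apply: alg_mor_eq; exact: compm1. Qed.
Next Obligation.
by move=> C T A B D E h g f; apply: alg_mor_eq; exact: compA.
Qed.

Record bij (X Y : finType) := Bij {
  bfun :> X -> Y;
  binv : Y -> X;
  bfunK : cancel bfun binv;
  binvK : cancel binv bfun }.

Lemma bij_eq (X Y : finType) (f g : bij X Y) : bfun f =1 bfun g -> f = g.
Proof.
case: f g => [f f' fK f'K] [g g' gK g'K] /= /funext fg; subst g.
have eg : f' = g' by apply: funext => y; rewrite -{1}(g'K y) fK.
by subst g'; congr Bij; exact: Prop_irrelevance.
Qed.

Definition id_bij (X : finType) : bij X X :=
  @Bij X X id id (fun _ => erefl) (fun _ => erefl).

Program Definition comp_bij (X Y Z : finType) (g : bij Y Z) (f : bij X Y) :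
  bij X Z := @Bij X Z (fun x => g (f x)) (fun z => binv f (binv g z)) _ _.
Next Obligation. by move=> X Y Z g f x; rewrite !bfunK. Qed.
Next Obligation. by move=> X Y Z g f z; rewrite !binvK. Qed.

(* The category B^S: [edge] is the adjoined object.  In [hom edge edge = bool],
   [true] is tau; the pair [(x, b)] in [hom edge (Fin X)] is ch_x if [b = false]
   and ch_x o tau if [b = true]. *)
Inductive BSobj := edge | Fin of finType.

Definition BShom (a b : BSobj) : Type :=
  match a, b with
  | edge, edge => bool
  | edge, Fin X => (X * bool)%type
  | Fin X, Fin Y => bij X Y
  | Fin _, edge => Empty_set
  end.

Definition BSid (a : BSobj) : BShom a a :=
  match a with edge => false | Fin X => id_bij X end.

Definition BScomp (a b c : BSobj) : BShom b c -> BShom a b -> BShom a c :=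
  match a, b, c return BShom b c -> BShom a b -> BShom a c with
  | edge, edge, edge => fun s t => s (+) t
  | edge, edge, Fin X => fun p t => (p.1, p.2 (+) t)
  | edge, Fin X, Fin Y => fun f p => (f p.1, p.2)
  | Fin X, Fin Y, Fin Z => fun g f => comp_bij g f
  | _, Fin X, edge => fun e _ => match e with end
  | Fin X, edge, _ => fun _ e => match e with end
  end.

Program Definition BS : Category := {|
  obj := BSobj;
  hom := BShom;
  idm := BSid;
  comp := BScomp |}.
Next Obligation.
by move=> [|X] [|Y] //= => [[x t]|f] //; apply: bij_eq.
Qed.
Next Obligation.
by move=> [|X] [|Y] //= => [t|[x t]|f]; rewrite ?addbF //; apply: bij_eq.
Qed.
Next Obligation.
move=> [|X] [|Y] [|Z] [|W] //= h g f; rewrite ?addbA //; exact: bij_eq.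
Qed.

Definition GS : Category := functor_cat (opposite BS) SET.

Definition colours (S : GS) : Type := fobj S edge.
Definition elts (S : GS) (X : finType) : Type := fobj S (Fin X).

Definition inv_tau (S : GS) : colours S -> colours S :=
  @fmap _ _ S edge edge true.
Definition chm (S : GS) (X : finType) (x : X) : elts S X -> colours S :=
  @fmap _ _ S (Fin X) edge (x, false).
Definition chm_tau (S : GS) (X : finType) (x : X) : elts S X -> colours S :=
  @fmap _ _ S (Fin X) edge (x, true).
Definition act (S : GS) (X Y : finType) (f : bij X Y) : elts S Y -> elts S X :=
  @fmap _ _ S (Fin Y) (Fin X) f.

Definition map_colours (S S' : GS) (f : hom S S') : colours S -> colours S' :=
  ntc f edge.
Definition map_elts (S S' : GS) (f : hom S S') (X : finType) :
  elts S X -> elts S' X := ntc f (Fin X).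

Lemma inv_tauK (S : GS) : involutive (@inv_tau S).
Proof.
move=> c.
have := congr1 (fun h => h c) (@fmapM _ _ S edge edge edge true true).
move=> /esym e; apply: etrans e _.
exact: (congr1 (fun h => h c) (@fmap1 _ _ S edge)).
Qed.

Lemma chm_tauE (S : GS) (X : finType) (x : X) (a : elts S X) :
  chm_tau x a = inv_tau (chm x a).
Proof.
by have /(congr1 (fun h => h a)) :=
  @fmapM _ _ S (Fin X) edge edge true (x, false).
Qed.

Lemma chm_act (S : GS) (X Y : finType) (f : bij X Y) (x : X) (a : elts S Y) :
  chm x (act f a) = chm (f x) a.
Proof.
by have /(congr1 (fun h => h a)) /= :=
  @fmapM _ _ S (Fin Y) (Fin X) edge (x, false) f.
Qed.

Lemma map_chm (S S' : GS) (f : hom S S') (X : finType) (x : X) (a : elts S X) :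
  chm x (map_elts f a) = map_colours f (chm x a).
Proof.
by have /(congr1 (fun h => h a)) /= :=
  ntN f ((x, false) : @hom (opposite BS) (Fin X) edge).
Qed.

Lemma map_inv_tau (S S' : GS) (f : hom S S') (c : colours S) :
  inv_tau (map_colours f c) = map_colours f (inv_tau c).
Proof.
by have /(congr1 (fun h => h c)) /= :=
  ntN f (true : @hom (opposite BS) edge edge).
Qed.

Definition dsum (X Y : finType) : finType := (X + Y)%type.

Definition rem2 (X : finType) (x y : X) : finType :=
  {z : X | (z != x) && (z != y)}.

Lemma neq_sym (X : finType) (x y : X) : x != y -> y != x.
Proof. by rewrite eq_sym. Qed.

Definition in_rem2 (X : finType) (x y z : X) (zx : z != x) (zy : z != y) :
  rem2 x y := exist _ z (introT andP (conj zx zy)).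

Lemma in_rem2_neq (X : finType) (x y z w : X) (zx : z != x) (zy : z != y)
  (wx : w != x) (wy : w != y) : z != w -> in_rem2 zx zy != in_rem2 wx wy.
Proof. by []. Qed.

Lemma inl_neq (X Y : finType) (x y : X) :
  x != y -> (inl x : dsum X Y) != inl y.
Proof. by []. Qed.

Lemma bij_neq (X Y : finType) (f : bij X Y) (x y : X) : x != y -> f x != f y.
Proof. by apply: contra_neq => /(can_inj (bfunK f)). Qed.

Definition bij_sum (X Y X' Y' : finType) (f : bij X X') (g : bij Y Y') :
  bij (dsum X Y) (dsum X' Y').
Proof.
exists (fun u : X + Y => match u with inl x => inl (f x) | inr y => inr (g y) end)
       (fun u : X' + Y' => match u with
          | inl x => inl (binv f x) | inr y => inr (binv g y) end).
- by move=> [x|y]; rewrite bfunK.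
- by move=> [x|y]; rewrite binvK.
Defined.

Definition bij_swap (X Y : finType) : bij (dsum X Y) (dsum Y X).
Proof.
exists (fun u : X + Y => match u with inl x => inr x | inr y => inl y end)
       (fun u : Y + X => match u with inl y => inr y | inr x => inl x end);
  by case.
Defined.

Definition bij_assoc (X Y Z : finType) :
  bij (dsum (dsum X Y) Z) (dsum X (dsum Y Z)).
Proof.
exists (fun u : (X + Y) + Z => match u with
          | inl (inl x) => inl x | inl (inr y) => inr (inl y)
          | inr z => inr (inr z) end)
       (fun u : X + (Y + Z) => match u with
          | inl x => inl (inl x) | inr (inl y) => inl (inr y)
          | inr (inr z) => inr z end);
  by repeat case.
Defined.

Definition bij_sum0 (X : finType) : bij (dsum X 'I_0) X.
Proof.
exists (fun u : X + 'I_0 => match u with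
          | inl x => x | inr i => False_rect X (notF (valP i)) end)
       (fun x : X => inl x); last by [].
by move=> [x|[]].
Defined.

Lemma rem2_restr_subproof (X Y : finType) (f : bij X Y) (x y : X)
  (u : rem2 x y) : (f (val u) != f x) && (f (val u) != f y).
Proof. by case: u => u /= /andP[ux uy]; rewrite !bij_neq. Qed.

Lemma rem2_restr_inv_subproof (X Y : finType) (f : bij X Y) (x y : X)
  (u : rem2 (f x) (f y)) : (binv f (val u) != x) && (binv f (val u) != y).
Proof.
by case: u => u /= /andP[ux uy]; rewrite !(can2_eq (binvK f) (bfunK f)) ux.
Qed.

(* The restriction of [f] to X \ {x, y}. *)
Definition bij_restr (X Y : finType) (f : bij X Y) (x y : X) :
  bij (rem2 x y) (rem2 (f x) (f y)).
Proof.
exists (fun u : rem2 x y =>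
          exist _ (f (val u)) (rem2_restr_subproof f u) : rem2 (f x) (f y))
       (fun u : rem2 (f x) (f y) =>
          exist _ (binv f (val u)) (rem2_restr_inv_subproof u) : rem2 x y).
- by move=> u; apply: val_inj; rewrite /= bfunK.
- by move=> u; apply: val_inj; rewrite /= binvK.
Defined.

Lemma rem2C_subproof (X : finType) (x y : X) (u : rem2 x y) :
  (val u != y) && (val u != x).
Proof. by rewrite andbC (valP u). Qed.

Definition bij_rem2C (X : finType) (x y : X) : bij (rem2 x y) (rem2 y x).
Proof.
exists (fun u : rem2 x y => exist _ (val u) (rem2C_subproof u) : rem2 y x)
       (fun u : rem2 y x => exist _ (val u) (rem2C_subproof u) : rem2 x y);
  by move=> u; apply: val_inj.
Defined.

Lemma rem2_rem2_subproof1 (X : finType) (w x y z : X)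
  (yw : y != w) (yx : y != x) (zw : z != w) (zx : z != x)
  (u : rem2 (in_rem2 yw yx) (in_rem2 zw zx)) :
  (val (val u) != y) && (val (val u) != z).
Proof. exact: valP u. Qed.

Lemma rem2_rem2_subproof2 (X : finType) (w x y z : X)
  (yw : y != w) (yx : y != x) (zw : z != w) (zx : z != x)
  (wy : w != y) (wz : w != z) (xy : x != y) (xz : x != z)
  (u : rem2 (in_rem2 yw yx) (in_rem2 zw zx)) :
  let v : rem2 y z := exist _ (val (val u)) (rem2_rem2_subproof1 u) in
  (v != in_rem2 wy wz) && (v != in_rem2 xy xz).
Proof. exact: valP (val u). Qed.

(* (X \ {w, x}) \ {y, z} = (X \ {y, z}) \ {w, x} *)
Definition bij_rem2_rem2 (X : finType) (w x y z : X)
  (yw : y != w) (yx : y != x) (zw : z != w) (zx : z != x)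
  (wy : w != y) (wz : w != z) (xy : x != y) (xz : x != z) :
  bij (rem2 (in_rem2 yw yx) (in_rem2 zw zx))
      (rem2 (in_rem2 wy wz) (in_rem2 xy xz)).
Proof.
exists (fun u : rem2 (in_rem2 yw yx) (in_rem2 zw zx) =>
          exist _ (exist _ (val (val u)) (rem2_rem2_subproof1 u))
                  (rem2_rem2_subproof2 wy wz xy xz u) :
          rem2 (in_rem2 wy wz) (in_rem2 xy xz))
       (fun u : rem2 (in_rem2 wy wz) (in_rem2 xy xz) =>
          exist _ (exist _ (val (val u)) (rem2_rem2_subproof1 u))
                  (rem2_rem2_subproof2 yw yx zw zx u) :
          rem2 (in_rem2 yw yx) (in_rem2 zw zx));
  by move=> u; do 2!apply: val_inj.
Defined.

Lemma rem2_suml_subproof (X Y : finType) (x y : X)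
  (u : dsum (rem2 x y) Y) :
  let v : dsum X Y :=
    match u with inl z => inl (val z) | inr t => inr t end in
  (v != inl x) && (v != inl y).
Proof. by case: u => [[z /= zP]|t]. Qed.

Lemma rem2_suml_inv_subproof (X Y : finType) (x y z : X) :
  ((inl z : dsum X Y) != inl x) && ((inl z : dsum X Y) != inl y) ->
  (z != x) && (z != y).
Proof. by []. Qed.

(* (X + Y) \ {x, y} = (X \ {x, y}) + Y for x, y in X *)
Definition bij_rem2_suml (X Y : finType) (x y : X) :
  bij (rem2 (inl x : dsum X Y) (inl y)) (dsum (rem2 x y) Y).
Proof.
exists (fun u : rem2 (inl x : dsum X Y) (inl y) =>
          match u with
          | exist (inl z) zP => inl (exist _ z (rem2_suml_inv_subproof zP))
          | exist (inr t) _ => inr t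
          end)
       (fun u : dsum (rem2 x y) Y =>
          exist _ (match u with inl z => inl (val z) | inr t => inr t end)
                  (rem2_suml_subproof u) :
          rem2 (inl x : dsum X Y) (inl y)).
- by move=> [[z|t] zP]; apply: val_inj.
- by move=> [z|t] //; congr inl; apply: val_inj.
Defined.

(* The elements 1 and 2 of the set {1, 2}, and its non-identity permutation. *)
Definition one2 : 'I_2 := ord0.
Definition two2 : 'I_2 := ord_max.

Definition sigma2 : bij 'I_2 'I_2 :=
  @Bij 'I_2 'I_2 (@rev_ord 2) (@rev_ord 2) (@rev_ordK 2) (@rev_ordK 2).

Lemma rem2_unit_subproof (X : finType) (x z : X) :
  let v : dsum X 'I_2 := if z == x then inr one2 else inl z in
  (v != inl x) && (v != inr two2).
Proof.
by case: eqP => [//|/eqP zx] /=; apply/andP.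
Qed.

(* (X + {1, 2}) \ {x, 2} = (X \ {x}) + {1} = X, where 1 is sent to x *)
Definition bij_rem2_unit (X : finType) (x : X) :
  bij (rem2 (inl x : dsum X 'I_2) (inr two2)) X.
Proof.
exists (fun u : rem2 (inl x : dsum X 'I_2) (inr two2) =>
          match val u with inl z => z | inr _ => x end)
       (fun z : X =>
          exist _ (if z == x then inr one2 else inl z)
                  (rem2_unit_subproof x z) :
          rem2 (inl x : dsum X 'I_2) (inr two2)).
- move=> [[z|i] /= zP]; apply: val_inj => /=.
    by case/andP: zP => zx _; rewrite ifN.
  rewrite eqxx; congr inr; apply: val_inj.
  by case: i zP => [[|[|]]].
- by move=> z /=; case: eqP.
Defined.

(* [contractible S x y] is the domain of the contraction of x with y: the
   elements a with S(ch_x)(a) = S(ch_y o tau)(a). *)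
Definition is_contractible (S : GS) (X : finType) (x y : X) (a : elts S X) :
  Prop := chm x a = chm_tau y a.

Definition contractible (S : GS) (X : finType) (x y : X) : Type :=
  {a : elts S X | is_contractible x y a}.

Lemma contractibleC (S : GS) (X : finType) (x y : X) (a : elts S X) :
  is_contractible x y a -> is_contractible y x a.
Proof. by rewrite /is_contractible !chm_tauE => ->; rewrite inv_tauK. Qed.

Lemma contractible_act (S : GS) (X Y : finType) (f : bij X Y) (x y : X)
  (a : elts S Y) :
  is_contractible (f x) (f y) a -> is_contractible x y (act f a).
Proof. by rewrite /is_contractible !chm_tauE !chm_act. Qed.

Lemma contractible_map (S S' : GS) (f : hom S S') (X : finType) (x y : X)
  (a : elts S X) : is_contractible x y a -> is_contractible x y (map_elts f a).
Proof.
by rewrite /is_contractible !chm_tauE !map_chm map_inv_tau => ->.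
Qed.

Record contraction (S : GS) := {
  ctr : forall (X : finType) (x y : X), x != y ->
    contractible S x y -> elts S (rem2 x y);
  ctr_sym : forall (X : finType) (x y : X) (xy : x != y) (a : elts S X)
      (ac : is_contractible x y a),
    ctr xy (exist _ a ac) =
    act (bij_rem2C x y)
        (ctr (neq_sym xy) (exist _ a (contractibleC ac)));
  ctr_act : forall (X Z : finType) (f : bij X Z) (x y : X) (xy : x != y)
      (a : elts S Z) (ac : is_contractible (f x) (f y) a),
    act (bij_restr f x y) (ctr (bij_neq f xy) (exist _ a ac)) =
    ctr xy (exist _ (act f a) (contractible_act ac));
  ctr_chm : forall (X : finType) (x y : X) (xy : x != y)
      (a : contractible S x y) (v : rem2 x y),
    chm v (ctr xy a) = chm (val v) (proj1_sig a) }.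

Record ext_product (S : GS) := {
  prd : forall X Y : finType, elts S X -> elts S Y -> elts S (dsum X Y);
  prd_act : forall (X Y X' Y' : finType) (f : bij X X') (g : bij Y Y')
      (a : elts S X') (b : elts S Y'),
    act (bij_sum f g) (prd a b) = prd (act f a) (act g b);
  prdC : forall (X Y : finType) (a : elts S X) (b : elts S Y),
    prd a b = act (bij_swap X Y) (prd b a);
  prd_chm : forall (X Y : finType) (a : elts S X) (b : elts S Y) (x : X),
    chm (inl x : dsum X Y) (prd a b) = chm x a;
  prd0 : elts S 'I_0;
  prd_unit : forall (X : finType) (a : elts S X),
    prd a prd0 = act (bij_sum0 X) a }.

Lemma prd_chmr (S : GS) (P : ext_product S) (X Y : finType) (a : elts S X)
  (b : elts S Y) (y : Y) : chm (inr y : dsum X Y) (prd P a b) = chm y b.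
Proof. by rewrite prdC chm_act prd_chm. Qed.

Lemma contractible_ctr (S : GS) (Z : contraction S) (X : finType) (w x y z : X)
  (wx : w != x) (yw : y != w) (yx : y != x) (zw : z != w) (zx : z != x)
  (a : elts S X) (awx : is_contractible w x a) :
  is_contractible y z a ->
  is_contractible (in_rem2 yw yx) (in_rem2 zw zx)
    (ctr Z wx (exist _ a awx)).
Proof. by rewrite /is_contractible !chm_tauE !ctr_chm. Qed.

Lemma contractible_prd (S : GS) (P : ext_product S) (X Y : finType) (x y : X)
  (a : elts S X) (b : elts S Y) :
  is_contractible x y a -> is_contractible (inl x) (inl y) (prd P a b).
Proof. by rewrite /is_contractible !chm_tauE !prd_chm. Qed.

Record NonunitalCircuitAlgebra := {
  nca_species :> GS;
  nca_prd : ext_product nca_species;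
  nca_ctr : contraction nca_species;
  nca_prdA : forall (X Y Z : finType) (a : elts nca_species X)
      (b : elts nca_species Y) (c : elts nca_species Z),
    prd nca_prd (prd nca_prd a b) c =
    act (bij_assoc X Y Z) (prd nca_prd a (prd nca_prd b c));
  nca_ctrC : forall (X : finType) (w x y z : X) (wx : w != x) (yz : y != z)
      (yw : y != w) (yx : y != x) (zw : z != w) (zx : z != x)
      (a : elts nca_species X)
      (awx : is_contractible w x a) (ayz : is_contractible y z a),
    ctr nca_ctr (in_rem2_neq yw yx zw zx yz)
      (exist _ _ (contractible_ctr nca_ctr wx yw yx zw zx awx ayz)) =
    act (bij_rem2_rem2 yw yx zw zx
           (neq_sym yw) (neq_sym zw) (neq_sym yx) (neq_sym zx))
      (ctr nca_ctr
         (in_rem2_neq (neq_sym yw) (neq_sym zw) (neq_sym yx) (neq_sym zx) wx)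
         (exist _ _ (contractible_ctr nca_ctr yz (neq_sym yw) (neq_sym zw)
                       (neq_sym yx) (neq_sym zx) ayz awx)));
  nca_ctr_prd : forall (X Y : finType) (x y : X) (xy : x != y)
      (a : elts nca_species X) (ac : is_contractible x y a)
      (b : elts nca_species Y),
    ctr nca_ctr (inl_neq Y xy) (exist _ _ (contractible_prd nca_prd b ac)) =
    act (bij_rem2_suml Y x y)
      (prd nca_prd (ctr nca_ctr xy (exist _ a ac)) b) }.

Record unit_like (S : GS) := {
  ulk :> colours S -> elts S 'I_2;
  ulk_tau : forall c, ulk (inv_tau c) = act sigma2 (ulk c);
  ulk_chm : forall c, chm one2 (ulk c) = c }.

Lemma contractible_unit (S : GS) (P : ext_product S) (e : unit_like S)
  (X : finType) (x : X) (a : elts S X) :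
  is_contractible (inl x) (inr two2) (prd P a (e (chm x a))).
Proof.
rewrite /is_contractible chm_tauE prd_chm prd_chmr.
have -> : two2 = sigma2 one2 by apply: val_inj.
by rewrite -chm_act -ulk_tau ulk_chm inv_tauK.
Qed.

Lemma inl_inr_neq (X Y : finType) (x : X) (y : Y) :
  (inl x : dsum X Y) != inr y.
Proof. by []. Qed.

Record CircuitAlgebra := {
  ca_nca :> NonunitalCircuitAlgebra;
  ca_unit : unit_like ca_nca;
  ca_unitP : forall (X : finType) (x : X) (a : elts ca_nca X),
    ctr (nca_ctr ca_nca) (inl_inr_neq x two2)
      (exist _ _ (contractible_unit (nca_prd ca_nca) ca_unit x a)) =
    act (bij_rem2_unit x) a }.

Record CircuitAlgebraMor (A B : CircuitAlgebra) := {
  ca_mor :> @hom GS A B;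
  ca_mor_prd : forall (X Y : finType) (a : elts A X) (b : elts A Y),
    map_elts ca_mor (prd (nca_prd A) a b) =
    prd (nca_prd B) (map_elts ca_mor a) (map_elts ca_mor b);
  ca_mor_prd0 : map_elts ca_mor (prd0 (nca_prd A)) = prd0 (nca_prd B);
  ca_mor_ctr : forall (X : finType) (x y : X) (xy : x != y) (a : elts A X)
      (ac : is_contractible x y a),
    map_elts ca_mor (ctr (nca_ctr A) xy (exist _ a ac)) =
    ctr (nca_ctr B) xy
      (exist _ (map_elts ca_mor a) (contractible_map ca_mor ac));
  ca_mor_unit : forall c : colours A,
    map_elts ca_mor (ca_unit A c) = ca_unit B (map_colours ca_mor c) }.

Lemma ca_mor_eq (A B : CircuitAlgebra) (f g : CircuitAlgebraMor A B) :
  ca_mor f = ca_mor g -> f = g.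
Proof.
case: f g => [f f1 f2 f3 f4] [g g1 g2 g3 g4] /= fg; subst g.
by congr Build_CircuitAlgebraMor; exact: Prop_irrelevance.
Qed.

Program Definition id_ca (A : CircuitAlgebra) : CircuitAlgebraMor A A :=
  {| ca_mor := @idm GS A |}.
Next Obligation. by []. Qed.
Next Obligation. by []. Qed.
Next Obligation.
move=> A X x y xy a ac; rewrite /map_elts /=; congr (ctr (nca_ctr A) xy _).
by congr exist; exact: Prop_irrelevance.
Qed.
Next Obligation. by []. Qed.

Program Definition comp_ca (A B C : CircuitAlgebra)
    (g : CircuitAlgebraMor B C) (f : CircuitAlgebraMor A B) :
  CircuitAlgebraMor A C := {| ca_mor := ca_mor g o ca_mor f |}.
Next Obligation.
move=> A B C g f X Y a b.
exact: etrans (congr1 (@map_elts _ _ g _) (ca_mor_prd f a b))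
              (ca_mor_prd g _ _).
Qed.
Next Obligation.
move=> A B C g f.
exact: etrans (congr1 (@map_elts _ _ g _) (ca_mor_prd0 f)) (ca_mor_prd0 g).
Qed.
Next Obligation.
move=> A B C g f X x y xy a ac.
apply: etrans (congr1 (@map_elts _ _ g _) (ca_mor_ctr f xy ac)) _.
rewrite ca_mor_ctr; congr (ctr (nca_ctr C) xy _); congr exist;
  exact: Prop_irrelevance.
Qed.
Next Obligation.
move=> A B C g f c.
exact: etrans (congr1 (@map_elts _ _ g _) (ca_mor_unit f c))
              (ca_mor_unit g _).
Qed.

Program Definition CA : Category := {|
  obj := CircuitAlgebra;
  hom := fun A B => CircuitAlgebraMor A B;
  idm := fun A => id_ca A;
  comp := fun A B C g f => comp_ca g f |}.
Next Obligation. by move=> A B f; apply: ca_mor_eq; exact: comp1m. Qed.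
Next Obligation. by move=> A B f; apply: ca_mor_eq; exact: compm1. Qed.
Next Obligation.
by move=> A B C D h g f; apply: ca_mor_eq; exact: compA.
Qed.

(* Main.v *)
(* Circuit algebras have the operations prd, prd0, ctr and ulk, where the domain
   of ctr is cut out by an equation between colours; no operation creates a
   colour.  So the free circuit algebra on a species S has the colours of S, and
   its elements are the colour-respecting terms in the operations and in S, two
   terms being identified when they have the same boundary colours and the same
   value in every circuit algebra under S; all axioms then hold for free.  The
   monad is the one induced by this adjunction.  The comparison functor is
   essentially surjective because an algebra h : O S -> S is split by the unit
   eta, and its associativity says that h o op = h o op o (eta o h) for every
   operation op; hence op := h o op o eta is well behaved on S and every axiom
   is inherited from the free circuit algebra.  Fullness is similar. *)
From mathcomp Require Import all_boot.
From mathcomp Require Import boolp.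
Require Import Defs.

Set Implicit Arguments.
Unset Strict Implicit.
Unset Printing Implicit Defensive.

#[local] Obligation Tactic := idtac.

Local Open Scope cat_scope.

(** * Left adjoints, their monads and the comparison functor *)

(** The adjunction is given by universal arrows, so the free object is needed on objects only;
    functoriality and naturality follow from existence and uniqueness of extensions. *)
Record left_adjoint (C D : Category) (U : Functor D C) := LeftAdjoint {
  free_obj : C -> D;
  free_unit : forall a, hom a (U (free_obj a));
  free_ext : forall a b, hom a (U b) -> hom (free_obj a) b;
  free_extK : forall a b (f : hom a (U b)),
    fmap U (free_ext f) o free_unit a = f;
  free_ext_uniq : forall a b (g h : hom (free_obj a) b),
    fmap U g o free_unit a = fmap U h o free_unit a -> g = h }.

Section FreeMonad.
Context {C D : Category} {U : Functor D C} (L : left_adjoint U).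

Let eta := free_unit L.

Lemma free_extE a b (f : hom a (U b)) (g : hom (free_obj L a) b) :
  fmap U g o eta a = f -> g = free_ext L f.
Proof. by move=> gf; apply: free_ext_uniq; rewrite free_extK. Qed.

Lemma free_ext_comp a b c (g : hom b c) (f : hom a (U b)) :
  g o free_ext L f = free_ext L (fmap U g o f).
Proof. by apply: free_extE; rewrite fmapM -compA free_extK. Qed.

(** Together with [free_ext_comp] this rewrites a composite of extensions as one extension. Most
    laws of the monad and of the comparison functor then compare two maps under a single
    [free_ext]. *)
Lemma free_ext_pre a b c (g : hom b (U c)) (f : hom a b) :
  free_ext L g o free_ext L (eta b o f) = free_ext L (g o f).
Proof. by rewrite free_ext_comp compA free_extK. Qed.

Program Definition free_monad_fun : Functor C C := {|
  fobj := fun a => U (free_obj L a);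
  fmap := fun a b f => fmap U (free_ext L (eta b o f)) |}.
Next Obligation.
move=> *; rewrite /= -[RHS]fmap1; congr fmap; apply/esym/free_extE.
by rewrite fmap1 comp1m compm1.
Qed.
Next Obligation. by move=> *; rewrite /= -fmapM free_ext_pre compA. Qed.

Program Definition free_monad_unit : NatTrans (idF C) free_monad_fun :=
  {| ntc := eta |}.
Next Obligation. by move=> *; rewrite /= free_extK. Qed.

(** The extension of the identity is the counit of the adjunction, here at a free object. *)
Program Definition free_monad_mul :
    NatTrans (compF free_monad_fun free_monad_fun) free_monad_fun :=
  {| ntc := fun a => fmap U (free_ext L (idm (U (free_obj L a)))) |}.
Next Obligation.
by move=> *; rewrite /= -!fmapM free_ext_pre free_ext_comp comp1m compm1.
Qed.

Program Definition free_monad : Monad C := {|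
  mfun := free_monad_fun;
  munit := free_monad_unit;
  mmul := free_monad_mul |}.
Next Obligation. by move=> *; rewrite [LHS]free_extK. Qed.
Next Obligation.
move=> *; rewrite /= -fmapM free_ext_pre comp1m -[RHS]fmap1; congr fmap.
by apply/esym/free_extE; rewrite fmap1 comp1m.
Qed.
Next Obligation.
by move=> *; rewrite /= -!fmapM free_ext_pre free_ext_comp comp1m compm1.
Qed.

Program Definition comparison_obj (A : D) : Algebra free_monad := {|
  alg_carrier := U A;
  alg_act := fmap U (free_ext L (idm (U A))) |}.
Next Obligation. by move=> *; rewrite [LHS]free_extK. Qed.
Next Obligation.
by move=> *; rewrite /= -!fmapM free_ext_pre free_ext_comp comp1m compm1.
Qed.

Program Definition comparison_mor (A B : D) (f : hom A B) :
    AlgebraMor (comparison_obj A) (comparison_obj B) :=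
  {| alg_mor := fmap U f |}.
Next Obligation.
by move=> *; rewrite /= -!fmapM free_ext_pre free_ext_comp comp1m compm1.
Qed.

Program Definition comparison : Functor D (EilenbergMoore free_monad) := {|
  fobj := comparison_obj;
  fmap := comparison_mor |}.
Next Obligation. by move=> *; apply: alg_mor_eq; exact: fmap1. Qed.
Next Obligation. by move=> *; apply: alg_mor_eq; exact: fmapM. Qed.

End FreeMonad.

(** * Equivalences from fully faithful, essentially surjective functors *)

Definition fully_faithful (C D : Category) (F : Functor C D) : Prop :=
  forall a b (g : hom (F a) (F b)), exists! f : hom a b, fmap F f = g.

Definition essentially_surjective (C D : Category) (F : Functor C D) : Prop :=
  forall d, exists c (f : hom (F c) d), is_iso f.

Lemma equivalence_ff_eso (C D : Category) (F : Functor C D) :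
  fully_faithful F -> essentially_surjective F -> equivalent C D.
Proof.
move=> Fff Feso.
(* Fullness is only a proposition; the choice operator [cid] turns it into a function, as it does
   below for objects, isomorphisms and inverses. *)
have [pre preP] : {pre : forall a b, hom (F a) (F b) -> hom a b |
    forall a b g, fmap F (pre a b g) = g}.
  exists (fun a b g => sval (cid (Fff a b g))) => a b g.
  by case: cid => f [].
(* Faithfulness lets every equation in [C] be checked after applying [F], where [preP] removes the
   chosen preimages. *)
have Finj a b (f g : hom a b) : fmap F f = fmap F g -> f = g.
  move=> fg; have [h [_ hP]] := Fff _ _ (fmap F g).
  by rewrite -(hP _ fg) -(hP g).
pose G d := sval (cid (Feso d)).
pose e d : hom (F (G d)) d := sval (cid (svalP (cid (Feso d)))).
have eP d : is_iso (e d) := svalP (cid (svalP (cid (Feso d)))).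
pose i d := sval (cid (eP d)).
have [ie ei] : (forall d, i d o e d = idm _) /\ (forall d, e d o i d = idm _).
  by split=> d; have [] := svalP (cid (eP d)).
pose Gf a b (f : hom a b) := pre _ _ (i b o f o e a).
have Gf1 a : Gf a a (idm a) = idm (G a).
  by apply: Finj; rewrite preP fmap1 compm1 ie.
have GfM a b c (g : hom b c) (f : hom a b) :
    Gf a c (g o f) = Gf b c g o Gf a b f.
  apply: Finj; rewrite fmapM !preP !compA.
  by rewrite -[_ o e b o i b]compA ei compm1.
pose GF := Build_Functor Gf1 GfM.
exists F, GF; split.
  (* The isomorphism [e (F a)] lies in the image of [F]; lifting its inverse gives the component at
     [a]. *)
  pose t a : hom (idF C a) (compF GF F a) := pre a (G (F a)) (i (F a)).
  have tN a b (f : hom a b) : t b o f = fmap GF (fmap F f) o t a.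
    by apply: Finj; rewrite /= !fmapM !preP -compA ei compm1.
  exists (Build_NatTrans (F := idF C) tN) => a.
  exists (pre (G (F a)) a (e (F a))).
  by split; apply: Finj; rewrite fmapM !preP fmap1 ?ie ?ei.
have eN a b (f : hom a b) : e b o fmap F (fmap GF f) = f o e a.
  by rewrite /= preP !compA ei comp1m.
exists (Build_NatTrans (F := compF F GF) (G := idF D) eN) => d.
by exists (i d); split; [exact: ie|exact: ei].
Qed.

(** * The forgetful functor and elementary facts on species *)

Definition forget : Functor CA GS := {|
  fobj := fun A : CA => nca_species A : GS;
  fmap := fun (A B : CA) (f : hom A B) => ca_mor f;
  fmap1 := fun A => erefl;
  fmapM := fun A B C g f => erefl |}.

Lemma act1 (S : GS) (X : finType) (a : elts S X) : act (id_bij X) a = a.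
Proof. exact: (congr1 (fun h => h a) (@fmap1 _ _ S (Fin X))). Qed.

Lemma actM (S : GS) (X Y Z : finType) (g : bij Y Z) (f : bij X Y)
  (a : elts S Z) : act (comp_bij g f) a = act f (act g a).
Proof.
exact: (congr1 (fun h => h a) (@fmapM _ _ S (Fin Z) (Fin Y) (Fin X) f g)).
Qed.

Lemma map_act (S S' : GS) (f : hom S S') (X Y : finType) (g : bij X Y)
  (a : elts S Y) : map_elts f (act g a) = act g (map_elts f a).
Proof.
exact: (congr1 (fun h => h a) (ntN f (g : @hom (opposite BS) (Fin Y) (Fin X)))).
Qed.

(** In [BS] the arrow [(x, t)] is [ch_x] precomposed with [t]. This reduces naturality at such
    arrows to statements about [chm]. *)
Lemma fmap_chm (S : GS) (X : finType) (p : X * bool) (a : elts S X) :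
  @fmap _ _ S (Fin X) edge p a = @fmap _ _ S edge edge p.2 (chm p.1 a).
Proof.
case: p => x t.
exact: (congr1 (fun h => h a) (@fmapM _ _ S (Fin X) edge edge t (x, false))).
Qed.

Lemma ulk_chm_two (S : GS) (e : unit_like S) (c : colours S) :
  chm two2 (e c) = inv_tau c.
Proof.
have -> : two2 = sigma2 one2 by apply: val_inj.
by rewrite -chm_act -ulk_tau ulk_chm.
Qed.

Lemma sval_inj (T : Type) (P : T -> Prop) : injective (@proj1_sig T P).
Proof. by move=> [a aP] [b bP] /= ab; exact: eq_exist. Qed.

(** Arguments of a contraction carry proofs, which differ from one construction to another; proof
    irrelevance leaves only the underlying elements to compare. *)
Lemma ctr_eq (S : GS) (Z : contraction S) (X : finType) (x y : X)
    (xy xy' : x != y) (a b : contractible S x y) :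
  sval a = sval b -> ctr Z xy a = ctr Z xy' b.
Proof. by move=> /sval_inj ->; rewrite (Prop_irrelevance xy xy'). Qed.

(** * Coloured terms and their evaluation in a circuit algebra *)

(** Indexing by the boundary colouring makes the domain of [tctr] an equation between indices, so
    terms and their colours need not be defined simultaneously. The colouring in [tunit] is the one
    forced by [ulk_chm] and [ulk_chm_two]. *)
Inductive term (S : GS) : forall X : finType, (X -> colours S) -> Type :=
| tgen (X : finType) (a : elts S X) : term (fun x => chm x a)
| tact (X Y : finType) (g : bij X Y) (k : Y -> colours S) :
    term k -> term (fun x => k (g x))
| tprd (X Y : finType) (k : X -> colours S) (l : Y -> colours S) :
    term k -> term l ->
    term (X := dsum X Y)
      (fun u => match u with inl x => k x | inr y => l y end)
| tprd0 (k : 'I_0 -> colours S) : term k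
| tctr (X : finType) (x y : X) (xy : x != y) (k : X -> colours S) :
    k x = inv_tau (k y) -> term k -> term (fun v : rem2 x y => k (val v))
| tunit (c : colours S) :
    term (fun i : 'I_2 => if i == one2 then c else inv_tau c).

Section Eval.
Context {S : GS} {A : CircuitAlgebra} (f : @hom GS S A).

(** Values are bundled with their boundary colours because the recursion [eval] needs them at
    [tctr], where they prove that the value is contractible. *)
Definition coloured (X : finType) (k : X -> colours S) : Type :=
  {a : elts A X | forall x, chm x a = map_colours f (k x)}.

Definition eval_gen (X : finType) (a : elts S X) : coloured (fun x => chm x a).
Proof. by exists (map_elts f a) => x; exact: map_chm. Defined.

Definition eval_act (X Y : finType) (g : bij X Y) (k : Y -> colours S)
  (a : coloured k) : coloured (fun x => k (g x)).
Proof. by exists (act g (sval a)) => x; rewrite chm_act (svalP a). Defined.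

Definition eval_prd (X Y : finType) (k : X -> colours S) (l : Y -> colours S)
    (a : coloured k) (b : coloured l) :
  coloured (fun u : dsum X Y => match u with inl x => k x | inr y => l y end).
Proof.
exists (prd (nca_prd A) (sval a) (sval b)).
by case=> x; [rewrite prd_chm (svalP a)|rewrite prd_chmr (svalP b)].
Defined.

Definition eval_prd0 (k : 'I_0 -> colours S) : coloured k.
Proof. by exists (prd0 (nca_prd A)); case. Defined.

Lemma coloured_contractible (X : finType) (x y : X) (k : X -> colours S)
    (a : coloured k) :
  k x = inv_tau (k y) -> is_contractible x y (sval a).
Proof.
by move=> kxy; rewrite /is_contractible chm_tauE !(svalP a) map_inv_tau kxy.
Qed.

Definition eval_ctr (X : finType) (x y : X) (xy : x != y) (k : X -> colours S)
  (kxy : k x = inv_tau (k y)) (a : coloured k) :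
  coloured (fun v : rem2 x y => k (val v)).
Proof.
exists (ctr (nca_ctr A) xy (exist _ (sval a) (coloured_contractible a kxy))).
by move=> v; rewrite ctr_chm /= (svalP a).
Defined.

Definition eval_unit (c : colours S) :
  coloured (fun i => if i == one2 then c else inv_tau c).
Proof.
exists (ca_unit A (map_colours f c)) => i.
case: (eqVneq i one2) => [->|i1]; first by rewrite ulk_chm.
have -> : i = two2 by apply: val_inj; case: i i1 => [[|[|]]].
by rewrite ulk_chm_two map_inv_tau.
Defined.

Fixpoint eval (X : finType) (k : X -> colours S) (t : term k) : coloured k :=
  match t with
  | tgen X a => eval_gen a
  | tact X Y g k t => eval_act g (eval t)
  | tprd X Y k l t u => eval_prd (eval t) (eval u)
  | tprd0 k => eval_prd0 k
  | tctr X x y xy k kxy t => eval_ctr xy kxy (eval t)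
  | tunit c => eval_unit c
  end.

End Eval.

(** * The free circuit algebra on a species and its universal property *)

Section FreeCircuitAlgebra.
Context (S : GS).

Definition raw (X : finType) : Type := {k : X -> colours S & term k}.

Definition rawc (X : finType) (t : raw X) : X -> colours S := tag t.
Definition rawv (A : CircuitAlgebra) (f : @hom GS S A) (X : finType)
  (t : raw X) : elts A X := sval (eval f (tagged t)).

(* Quantifying over all circuit algebras is harmless for the size of the
   quotient because Prop is impredicative. *)
Definition raw_eq (X : finType) (t u : raw X) : Prop :=
  rawc t =1 rawc u /\
  forall (A : CircuitAlgebra) (f : @hom GS S A), rawv f t = rawv f u.

(** The quotient is the type of equivalence classes, taken as predicates; [rep] selects a member of
    a class by choice. *)
Definition free_elts (X : finType) : Type :=
  {P : raw X -> Prop | exists t, P = raw_eq t}.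

Definition cls (X : finType) (k : X -> colours S) (t : term k) : free_elts X :=
  exist _ (raw_eq (Tagged _ t)) (ex_intro _ (Tagged _ t) erefl).

Definition rep (X : finType) (q : free_elts X) : raw X := sval (cid (svalP q)).

Definition fcol (X : finType) (q : free_elts X) : X -> colours S :=
  rawc (rep q).

Definition fval (A : CircuitAlgebra) (f : @hom GS S A) (X : finType)
  (q : free_elts X) : elts A X := rawv f (rep q).

(** The class of [t] and that of its chosen representative are the same predicate, and [t] satisfies
    the former. *)
Lemma rep_cls (X : finType) (k : X -> colours S) (t : term k) :
  raw_eq (rep (cls t)) (Tagged _ t).
Proof. by rewrite /rep; case: cid => u /= <-; split. Qed.

Lemma cls_rep (X : finType) (q : free_elts X) : cls (tagged (rep q)) = q.
Proof.
apply: sval_inj => /=; rewrite /rep; case: cid => t /= ->.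
by case: t.
Qed.

Lemma fcol_cls (X : finType) (k : X -> colours S) (t : term k) :
  fcol (cls t) =1 k.
Proof. by case: (rep_cls t). Qed.

Lemma fval_cls (A : CircuitAlgebra) (f : @hom GS S A) (X : finType)
    (k : X -> colours S) (t : term k) :
  fval f (cls t) = sval (eval f t).
Proof. by case: (rep_cls t) => _ /(_ A f). Qed.

(** This is how each equation between elements of the free algebra is proved below: colours are
    computed directly, and for values the same axiom is applied in the target [A]. *)
Lemma free_elts_eq (X : finType) (q r : free_elts X) : fcol q =1 fcol r ->
  (forall (A : CircuitAlgebra) (f : @hom GS S A), fval f q = fval f r) -> q = r.
Proof.
move=> qrc qrv; apply: sval_inj; have -> : sval q = raw_eq (rep q).
  by rewrite {1}/rep; case: cid.
have -> : sval r = raw_eq (rep r) by rewrite {1}/rep; case: cid.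
apply: funext => t; apply: propext; split=> -[tc tv].
  by split=> [x|A f]; [rewrite -tc; exact/esym/qrc|rewrite -tv; exact/esym/qrv].
by split=> [x|A f]; [rewrite -tc; exact: qrc|rewrite -tv; exact: qrv].
Qed.

Lemma fval_chm (A : CircuitAlgebra) (f : @hom GS S A) (X : finType)
  (x : X) (q : free_elts X) : chm x (fval f q) = map_colours f (fcol q x).
Proof. exact: svalP (eval f (tagged (rep q))) x. Qed.

#[local] Arguments act : simpl never.
#[local] Arguments chm : simpl never.

Definition free_act (X Y : finType) (g : bij X Y) (q : free_elts Y) :
  free_elts X := cls (tact g (tagged (rep q))).

Lemma fcol_free_act (X Y : finType) (g : bij X Y) (q : free_elts Y) (x : X) :
  fcol (free_act g q) x = fcol q (g x).
Proof. exact: fcol_cls. Qed.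

Lemma fval_free_act (A : CircuitAlgebra) (f : @hom GS S A) (X Y : finType)
    (g : bij X Y) (q : free_elts Y) :
  fval f (free_act g q) = act g (fval f q).
Proof. exact: fval_cls. Qed.

Definition free_fobj (a : opposite BS) : SET :=
  match a with edge => colours S | Fin X => free_elts X end.

Definition free_fmap (a b : opposite BS) :
    hom a b -> free_fobj a -> free_fobj b :=
  match a, b return BShom b a -> free_fobj a -> free_fobj b with
  | edge, edge => fun t => @fmap _ _ S edge edge t
  | Fin X, edge => fun p q => @fmap _ _ S edge edge p.2 (fcol q p.1)
  | Fin X, Fin Y => fun g q => free_act g q
  | edge, Fin X => fun e => match e with end
  end.

Program Definition free_species : GS := {|
  fobj := free_fobj;
  fmap := free_fmap |}.
Next Obligation.
case=> [|X]; first exact: (@fmap1 _ _ S edge).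
apply: funext => q; apply: free_elts_eq => [x|A f].
  exact: fcol_free_act.
by rewrite [LHS]fval_free_act act1.
Qed.
Next Obligation.
case=> [|X] [|Y] [|Z] //= g f.
- exact: (@fmapM _ _ S edge edge edge).
- apply: funext => q.
  exact: (congr1 (fun h => h _) (@fmapM _ _ S edge edge edge g f.2)).
- by apply: funext => q; rewrite /= fcol_free_act.
- apply: funext => q; apply: free_elts_eq => [x|A h].
    by rewrite !fcol_free_act.
  by rewrite !fval_free_act actM.
Qed.

Lemma fcol_act (X Y : finType) (g : bij X Y) (q : elts free_species Y) (x : X) :
  fcol (act g q) x = fcol q (g x).
Proof. exact: fcol_free_act. Qed.

Lemma fval_act (A : CircuitAlgebra) (f : @hom GS S A) (X Y : finType)
    (g : bij X Y) (q : elts free_species Y) :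
  fval f (act g q) = act g (fval f q).
Proof. exact: fval_free_act. Qed.

Lemma free_chm (X : finType) (x : X) (q : elts free_species X) :
  chm x q = fcol q x.
Proof. exact: (congr1 (fun h => h _) (@fmap1 _ _ S edge)). Qed.

Definition free_prd (X Y : finType) (q : elts free_species X)
    (r : elts free_species Y) : elts free_species (dsum X Y) :=
  cls (tprd (tagged (rep q)) (tagged (rep r))).

Lemma fcol_prd (X Y : finType) (q : elts free_species X)
    (r : elts free_species Y) (u : dsum X Y) :
  fcol (free_prd q r) u =
  match u with inl x => fcol q x | inr y => fcol r y end.
Proof. exact: fcol_cls. Qed.

Lemma fval_prd (A : CircuitAlgebra) (f : @hom GS S A) (X Y : finType)
    (q : elts free_species X) (r : elts free_species Y) :
  fval f (free_prd q r) = prd (nca_prd A) (fval f q) (fval f r).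
Proof. exact: fval_cls. Qed.

Definition free_prd0 : elts free_species 'I_0 :=
  cls (tprd0 (fun i : 'I_0 => False_rect (colours S) (notF (valP i)))).

Lemma fval_prd0 (A : CircuitAlgebra) (f : @hom GS S A) :
  fval f free_prd0 = prd0 (nca_prd A).
Proof. exact: fval_cls. Qed.

Lemma fcol_contractible (X : finType) (x y : X) (q : elts free_species X) :
  is_contractible x y q -> fcol q x = inv_tau (fcol q y).
Proof. by rewrite /is_contractible chm_tauE !free_chm. Qed.

Definition free_ctr (X : finType) (x y : X) (xy : x != y)
    (q : contractible free_species x y) : elts free_species (rem2 x y) :=
  cls (tctr xy (fcol_contractible (proj2_sig q)) (tagged (rep (proj1_sig q)))).

Lemma fcol_ctr (X : finType) (x y : X) (xy : x != y)
    (q : contractible free_species x y) (v : rem2 x y) :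
  fcol (free_ctr xy q) v = fcol (proj1_sig q) (val v).
Proof. exact: fcol_cls. Qed.

Lemma fval_contractible (A : CircuitAlgebra) (f : @hom GS S A) (X : finType)
    (x y : X) (q : elts free_species X) :
  is_contractible x y q -> is_contractible x y (fval f q).
Proof. by move/fcol_contractible; exact: coloured_contractible. Qed.

Lemma fval_ctr (A : CircuitAlgebra) (f : @hom GS S A) (X : finType) (x y : X)
    (xy : x != y) (q : elts free_species X) (qc : is_contractible x y q) :
  fval f (free_ctr xy (exist _ q qc)) =
  ctr (nca_ctr A) xy (exist _ (fval f q) (fval_contractible f qc)).
Proof. by rewrite [LHS]fval_cls; exact: ctr_eq. Qed.

Definition free_ulk (c : colours free_species) : elts free_species 'I_2 :=
  cls (@tunit S c).

Lemma fcol_ulk (c : colours free_species) (i : 'I_2) :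
  fcol (free_ulk c) i = if i == one2 then c else inv_tau c.
Proof. exact: fcol_cls. Qed.

Lemma fval_ulk (A : CircuitAlgebra) (f : @hom GS S A)
    (c : colours free_species) :
  fval f (free_ulk c) = ca_unit A (map_colours f c).
Proof. exact: fval_cls. Qed.

Program Definition free_ext_product : ext_product free_species := {|
  prd := free_prd;
  prd0 := free_prd0 |}.
Next Obligation.
move=> X Y X' Y' f g a b; apply: free_elts_eq => [[x|x]|A h];
  rewrite ?(fcol_act, fcol_prd) //=.
by rewrite fval_act !fval_prd !fval_act prd_act.
Qed.
Next Obligation.
move=> X Y a b; apply: free_elts_eq => [[x|x]|A h];
  rewrite ?(fcol_act, fcol_prd) //=.
by rewrite fval_act !fval_prd prdC.
Qed.
Next Obligation. by move=> X Y a b x; rewrite !free_chm fcol_prd. Qed.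
Next Obligation.
move=> X a; apply: free_elts_eq => [[x|[]]|A h] //;
  rewrite ?(fcol_act, fcol_prd) //=.
by rewrite fval_act fval_prd fval_prd0 prd_unit.
Qed.

Program Definition free_contraction : contraction free_species := {|
  ctr := free_ctr |}.
Next Obligation.
move=> X x y xy a ac; apply: free_elts_eq => [v|A h].
  by rewrite fcol_act !fcol_ctr.
rewrite fval_act !fval_ctr ctr_sym; congr act; exact: ctr_eq.
Qed.
Next Obligation.
move=> X Z f x y xy a ac; apply: free_elts_eq => [v|A h].
  by rewrite fcol_act !fcol_ctr fcol_act.
rewrite fval_act !fval_ctr ctr_act; apply: ctr_eq => /=.
by rewrite fval_act.
Qed.
Next Obligation. by move=> X x y xy a v; rewrite !free_chm fcol_ctr. Qed.

Program Definition free_nca : NonunitalCircuitAlgebra := {|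
  nca_species := free_species;
  nca_prd := free_ext_product;
  nca_ctr := free_contraction |}.
Next Obligation.
move=> X Y Z a b c; apply: free_elts_eq => [[[x|x]|x]|A h];
  rewrite /= ?(fcol_act, fcol_prd) /= ?fcol_prd //.
by rewrite /= fval_act !fval_prd nca_prdA.
Qed.
Next Obligation.
move=> X w x y z wx yz yw yx zw zx a awx ayz.
apply: free_elts_eq => [v|A h].
  by rewrite /= fcol_act !fcol_ctr.
rewrite /= fval_act fval_ctr.
(* After evaluation the outer contraction still contains the value of an unevaluated inner one.
   Since its contractibility proof depends on that value, both sides are matched with the axiom in
   [A] through [ctr_eq]. *)
have := nca_ctrC wx yz yw yx zw zx
  (fval_contractible h awx) (fval_contractible h ayz).
move=> e; apply: etrans (etrans e _); last congr act.
  by apply: ctr_eq; exact: fval_ctr.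
by rewrite fval_ctr; apply: ctr_eq; apply/esym; exact: fval_ctr.
Qed.
Next Obligation.
move=> X Y x y xy a ac b; apply: free_elts_eq => [v|A h].
  rewrite /= fcol_act fcol_ctr /= !fcol_prd.
  by case: v => [[v|v] vP] /=; rewrite ?fcol_ctr.
rewrite /= fval_act fval_ctr [in RHS]fval_prd fval_ctr -nca_ctr_prd.
by apply: ctr_eq; exact: fval_prd.
Qed.

Program Definition free_unit_like : unit_like free_nca := {| ulk := free_ulk |}.
Next Obligation.
move=> c; apply: free_elts_eq => [i|A h].
  rewrite /= fcol_act !fcol_ulk [inv_tau (inv_tau c)]inv_tauK.
  by case: i => [[|[|]]].
by rewrite /= fval_act !fval_ulk -ulk_tau map_inv_tau.
Qed.
Next Obligation. by move=> c; rewrite free_chm fcol_ulk. Qed.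

Program Definition free_ca : CircuitAlgebra := {|
  ca_nca := free_nca;
  ca_unit := free_unit_like |}.
Next Obligation.
move=> X x a; apply: free_elts_eq => [v|A h].
  rewrite /= fcol_act fcol_ctr /= fcol_prd.
  case: v => [[v|v] vP] //=; rewrite fcol_ulk free_chm.
  by case: v vP => [[|[|]]].
rewrite /= fval_act fval_ctr -ca_unitP; apply: ctr_eq.
by rewrite /= fval_prd fval_ulk free_chm fval_chm.
Qed.

Definition gen (X : finType) (a : elts S X) : elts free_ca X := cls (tgen a).

(** The unit of the adjunction. That it is the identity on colours makes several later equations
    between colours hold by computation. *)
Program Definition gen_nat : @hom GS S free_ca := {|
  ntc := fun a => match a return fobj S a -> free_fobj a with
                  | edge => id
                  | Fin X => @gen X end |}.
Next Obligation.
case=> [|X] [|Y] //= f; apply: funext => a /=.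
- by rewrite fcol_cls fmap_chm.
- apply: (@free_elts_eq Y) => [x|A h].
    by rewrite fcol_free_act !fcol_cls chm_act.
  by rewrite fval_free_act !fval_cls; exact: map_act.
Qed.

Program Definition eval_nat (A : CircuitAlgebra) (f : @hom GS S A) :
  @hom GS free_ca A := {|
  ntc := fun a => match a return free_fobj a -> fobj (nca_species A) a with
                  | edge => map_colours f
                  | Fin X => @fval A f X end |}.
Next Obligation.
move=> A f; case=> [|X] [|Y] //= g; apply: funext => a /=.
- exact: (congr1 (fun h => h a) (@ntN _ _ _ _ f edge edge g)).
- apply: etrans (congr1 (fun h => h _) (@ntN _ _ _ _ f edge edge g.2)) _.
  by rewrite fmap_chm fval_chm.
- exact: fval_act.
Qed.

Program Definition eval_mor (A : CircuitAlgebra) (f : @hom GS S A) :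
  CircuitAlgebraMor free_ca A := {| ca_mor := eval_nat f |}.
Next Obligation. by move=> A f X Y a b; exact: fval_prd. Qed.
Next Obligation. by move=> A f; exact: fval_prd0. Qed.
Next Obligation.
move=> A f X x y xy a ac; apply: etrans (fval_ctr f xy ac) _; exact: ctr_eq.
Qed.
Next Obligation. by move=> A f c; exact: fval_ulk. Qed.

Lemma eval_gen_nat (A : CircuitAlgebra) (f : @hom GS S A) :
  @comp GS _ _ _ (eval_nat f) gen_nat = f.
Proof. by apply: nat_eq => -[|X] //; apply: funext => a; exact: fval_cls. Qed.

(** The operations on classes were defined through chosen representatives. This lemma and its
    analogues for the other constructors allow arbitrary terms, as induction on terms requires. *)
Lemma cls_act (X Y : finType) (g : bij X Y) (k : Y -> colours S) (t : term k) :
  cls (tact g t) = act g (cls t : elts free_species Y).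
Proof.
apply: free_elts_eq => [x|A f]; first by rewrite fcol_act !fcol_cls.
by rewrite fval_act !fval_cls.
Qed.

Lemma cls_prd (X Y : finType) (k : X -> colours S) (l : Y -> colours S)
    (t : term k) (u : term l) :
  cls (tprd t u) = prd free_ext_product (cls t) (cls u).
Proof.
apply: free_elts_eq => [[x|x]|A f]; rewrite ?fcol_prd ?fcol_cls //.
by rewrite fval_prd !fval_cls.
Qed.

Lemma cls_prd0 (k : 'I_0 -> colours S) :
  cls (tprd0 k) = prd0 free_ext_product.
Proof. by apply: free_elts_eq => [[]|A f] //; rewrite fval_prd0 fval_cls. Qed.

Lemma cls_contractible (X : finType) (x y : X) (k : X -> colours S)
    (t : term k) :
  k x = inv_tau (k y) ->
  is_contractible x y (cls t : elts free_species X).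
Proof.
by move=> kxy; rewrite /is_contractible chm_tauE !free_chm !fcol_cls.
Qed.

Lemma cls_ctr (X : finType) (x y : X) (xy : x != y) (k : X -> colours S)
    (kxy : k x = inv_tau (k y)) (t : term k) :
  cls (tctr xy kxy t) =
  ctr free_contraction xy (exist _ _ (cls_contractible t kxy)).
Proof.
apply: free_elts_eq => [v|A f]; first by rewrite fcol_ctr !fcol_cls.
by rewrite fval_ctr [LHS]fval_cls; apply: ctr_eq; rewrite /= fval_cls.
Qed.

(** Every element is the class of a term, so induction on that term applies: generators agree by
    hypothesis and both morphisms preserve each operation. *)
Lemma free_ca_uniq (A : CircuitAlgebra) (g h : CircuitAlgebraMor free_ca A) :
  @comp GS _ _ _ g gen_nat = @comp GS _ _ _ h gen_nat -> g = h.
Proof.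
move=> gh.
have ghc : map_colours g = map_colours h.
  exact (congr1 (fun t : @hom GS S A => ntc t edge) gh).
apply: ca_mor_eq; apply: nat_eq => -[|X] //; apply: funext => q.
rewrite -(cls_rep q); change (map_elts g (cls (tagged (rep q)) : elts free_ca X)
  = map_elts h (cls (tagged (rep q)) : elts free_ca X)).
elim: (tagged (rep q)) => {X q} [X a|X Y f k t IH|X Y k l t IHt u IHu|k|
  X x y xy k kxy t IH|c].
- exact (congr1 (fun t : @hom GS S A => ntc t (Fin X) a) gh).
- by rewrite cls_act !map_act IH.
- by rewrite cls_prd !ca_mor_prd IHt IHu.
- by rewrite cls_prd0 !ca_mor_prd0.
- by rewrite cls_ctr !ca_mor_ctr; exact: ctr_eq.
- by rewrite -[cls _]/(ca_unit free_ca c) !ca_mor_unit ghc.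
Qed.

End FreeCircuitAlgebra.

Definition free_adjoint : left_adjoint forget :=
  @LeftAdjoint _ _ forget free_ca gen_nat (fun S A f => eval_mor f)
    (fun S A f => eval_gen_nat f) (fun S A g h => @free_ca_uniq S A g h).

(* A circuit algebra structure descends along a split epimorphism of species
   whose kernel pair is a congruence. *)
Section Descent.
Context {A : CircuitAlgebra} {S : GS}.
Context (h : @hom GS A S) (s : @hom GS S A) (hs : @comp GS _ _ _ h s = idm S).

Context (h_prd : forall (X Y : finType) (a : elts A X) (b : elts A Y),
  map_elts h (prd (nca_prd A) a b) =
  map_elts h (prd (nca_prd A) (map_elts s (map_elts h a))
                              (map_elts s (map_elts h b)))).
Context (h_ctr : forall (X : finType) (x y : X) (xy : x != y) (a : elts A X)
    (ac : is_contractible x y a),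
  map_elts h (ctr (nca_ctr A) xy (exist _ a ac)) =
  map_elts h (ctr (nca_ctr A) xy (exist _ (map_elts s (map_elts h a))
                 (contractible_map s (contractible_map h ac))))).
Context (h_unit : forall c : colours A,
  map_elts h (ca_unit A c) =
  map_elts h (ca_unit A (map_colours s (map_colours h c)))).

Lemma map_eltsK (X : finType) (a : elts S X) : map_elts h (map_elts s a) = a.
Proof. exact (congr1 (fun t : @hom GS S S => ntc t (Fin X) a) hs). Qed.

Lemma map_coloursK (c : colours S) : map_colours h (map_colours s c) = c.
Proof. exact (congr1 (fun t : @hom GS S S => ntc t edge c) hs). Qed.

Lemma map_elts_surj (X : finType) (a : elts S X) :
  exists b : elts A X, map_elts h b = a.
Proof. by exists (map_elts s a); exact: map_eltsK. Qed.

Definition desc_prd (X Y : finType) (a : elts S X) (b : elts S Y) :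
  elts S (dsum X Y) :=
  map_elts h (prd (nca_prd A) (map_elts s a) (map_elts s b)).

Definition desc_ctr (X : finType) (x y : X) (xy : x != y)
    (a : contractible S x y) : elts S (rem2 x y) :=
  map_elts h (ctr (nca_ctr A) xy
    (exist _ (map_elts s (sval a)) (contractible_map s (proj2_sig a)))).

(** By [h_prd] any preimages may replace those chosen by [s]. As [h] is surjective, the axioms for
    the descended product become images under [h] of those in [A]. *)
Lemma desc_prdE (X Y : finType) (a : elts A X) (b : elts A Y) :
  desc_prd (map_elts h a) (map_elts h b) = map_elts h (prd (nca_prd A) a b).
Proof. by rewrite h_prd. Qed.

(** Since [h] may identify colours, a preimage of a contractible element need not be contractible;
    hence [ac]. Leaving [b] free up to an equation allows any contractibility proof on the side of
    [S]. *)
Lemma desc_ctrE (X : finType) (x y : X) (xy : x != y) (a : elts A X)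
    (b : contractible S x y) (ac : is_contractible x y a) :
  map_elts h a = sval b ->
  desc_ctr xy b = map_elts h (ctr (nca_ctr A) xy (exist _ a ac)).
Proof.
move=> ab; rewrite h_ctr; congr map_elts; apply: ctr_eq => /=.
by rewrite ab.
Qed.

Program Definition desc_ext_product : ext_product S := {|
  prd := desc_prd;
  prd0 := map_elts h (prd0 (nca_prd A)) |}.
Next Obligation.
move=> X Y X' Y' f g a b; case: (map_elts_surj a) (map_elts_surj b).
by move=> {a}a <- [{b}b <-]; rewrite desc_prdE -!map_act desc_prdE prd_act.
Qed.
Next Obligation.
move=> X Y a b; case: (map_elts_surj a) (map_elts_surj b).
by move=> {a}a <- [{b}b <-]; rewrite !desc_prdE -!map_act prdC.
Qed.
Next Obligation.
by move=> X Y a b x; rewrite map_chm prd_chm -map_chm map_eltsK.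
Qed.
Next Obligation.
move=> X a; case: (map_elts_surj a) => {a}a <-.
by rewrite desc_prdE prd_unit map_act.
Qed.

Program Definition desc_contraction : contraction S := {| ctr := desc_ctr |}.
Next Obligation.
move=> X x y xy a ac; rewrite [LHS]/desc_ctr ctr_sym map_act; congr act.
by apply/esym/desc_ctrE; exact: map_eltsK.
Qed.
Next Obligation.
move=> X Z f x y xy a ac; rewrite [in LHS]/desc_ctr -map_act ctr_act.
by apply/esym/desc_ctrE; rewrite map_act map_eltsK.
Qed.
Next Obligation.
by move=> X x y xy a v; rewrite map_chm ctr_chm -map_chm map_eltsK.
Qed.

Program Definition desc_nca : NonunitalCircuitAlgebra := {|
  nca_species := S;
  nca_prd := desc_ext_product;
  nca_ctr := desc_contraction |}.
Next Obligation.
move=> X Y Z a b c /=.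
case: (map_elts_surj a) (map_elts_surj b) (map_elts_surj c).
move=> {a}a <- [{b}b <-] [{c}c <-].
by rewrite !desc_prdE nca_prdA map_act.
Qed.
Next Obligation.
move=> X w x y z wx yz yw yx zw zx a awx ayz /=.
(* The inner descended contraction is the image under [h] of the contraction of [map_elts s a],
   which serves as preimage for the outer one. *)
rewrite (desc_ctrE _ (contractible_ctr (nca_ctr A) wx yw yx zw zx
  (contractible_map s awx) (contractible_map s ayz))) //.
rewrite nca_ctrC map_act; congr act.
by apply/esym/desc_ctrE.
Qed.
Next Obligation.
move=> X Y x y xy a ac b /=.
rewrite (desc_ctrE _ (contractible_prd (nca_prd A) (map_elts s b)
  (contractible_map s ac))) //.
by rewrite nca_ctr_prd map_act -desc_prdE map_eltsK.
Qed.

Program Definition desc_unit_like : unit_like desc_nca := {|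
  ulk := fun c =>
    map_elts h (ca_unit A (map_colours s c)) : elts desc_nca 'I_2 |}.
Next Obligation.
by move=> c; rewrite -[RHS]map_act -ulk_tau map_inv_tau.
Qed.
Next Obligation.
by move=> c; rewrite [LHS]map_chm ulk_chm map_coloursK.
Qed.

Program Definition desc_ca : CircuitAlgebra := {|
  ca_nca := desc_nca;
  ca_unit := desc_unit_like |}.
Next Obligation.
move=> X x a /=.
(* The preimage is the left side of the unit axiom of [A] at [map_elts s a] before contraction;
   naturality of [s] matches the colour fed to the unit. *)
rewrite (desc_ctrE _ (contractible_unit (nca_prd A) (ca_unit A) x
  (map_elts s a))).
  by rewrite ca_unitP map_act map_eltsK.
by rewrite /= -desc_prdE map_eltsK map_chm.
Qed.

Program Definition desc_mor : CircuitAlgebraMor A desc_ca := {| ca_mor := h |}.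
Next Obligation. exact: h_prd. Qed.
Next Obligation. by []. Qed.
Next Obligation. by move=> X x y xy a ac; apply/esym/desc_ctrE. Qed.
Next Obligation. exact: h_unit. Qed.

End Descent.

(** * The comparison functor is an equivalence *)

(** The section [s] writes every operation of [A] as the image under [e] of one in [F]; there [g]
    acts as [p], which preserves operations. *)
Lemma ca_mor_factor (F A B : CircuitAlgebra) (e : CircuitAlgebraMor F A)
    (s : @hom GS A F) (p : CircuitAlgebraMor F B) (g : @hom GS A B) :
  @comp GS _ _ _ e s = idm (A : GS) -> @comp GS _ _ _ g e = p ->
  exists f : CircuitAlgebraMor A B, ca_mor f = g.
Proof.
move=> es ge.
have esK (X : finType) (a : elts A X) : map_elts e (map_elts s a) = a.
  exact: map_eltsK.
have escK (c : colours A) : map_colours e (map_colours s c) = c.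
  exact: map_coloursK.
have geE (X : finType) (a : elts F X) :
    map_elts g (map_elts e a) = map_elts p a by rewrite -ge.
have gecE (c : colours F) : map_colours g (map_colours e c) = map_colours p c.
  by rewrite -ge.
unshelve eexists (@Build_CircuitAlgebraMor A B g _ _ _ _) => //.
- move=> X Y a b; rewrite -(esK _ a) -(esK _ b).
  by rewrite -ca_mor_prd !geE ca_mor_prd.
- by rewrite -(ca_mor_prd0 e) geE ca_mor_prd0.
- move=> X x y xy a ac.
  have -> : ctr (nca_ctr A) xy (exist _ a ac) = map_elts e
      (ctr (nca_ctr F) xy (exist _ (map_elts s a) (contractible_map s ac))).
    by rewrite ca_mor_ctr; apply: ctr_eq; rewrite /= esK.
  rewrite geE ca_mor_ctr; apply: ctr_eq => /=.
  by rewrite -geE esK.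
- move=> c; rewrite -(escK c) -ca_mor_unit geE ca_mor_unit.
  by rewrite gecE.
Qed.

Lemma comparison_ff : fully_faithful (comparison free_adjoint).
Proof.
move=> A B g.
(* Here [e] is the counit at [A], split by the unit, and [p] is the free morphism on [g] followed by
   the counit at [B]; the square defining an algebra morphism says that [g] after [e] is [p]. *)
have [f fg] := @ca_mor_factor (free_ca A) A B (eval_mor (idm (A : GS)))
  (gen_nat A) (comp_ca (eval_mor (idm (B : GS)))
    (eval_mor (@comp GS _ _ _ (gen_nat B) (alg_mor g)))) (alg_mor g)
  (eval_gen_nat _) (alg_morP g).
exists f; split; first exact: alg_mor_eq.
move=> f' /(congr1 (@alg_mor _ _ _ _)) f'g.
by apply: ca_mor_eq; rewrite fg -f'g.
Qed.

Lemma comparison_eso : essentially_surjective (comparison free_adjoint).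
Proof.
move=> d; set S := alg_carrier d.
pose h : @hom GS (free_ca S) S := alg_act d.
pose eta : @hom GS S (free_ca S) := gen_nat S.
have h_eta : @comp GS _ _ _ h eta = idm S := alg_unit d.
(* [Th] is the monad applied to [h], and [mu] below is its multiplication. Both preserve the
   operations, and the associativity law of [d] says that [h] coequalises them. *)
pose Th : CircuitAlgebraMor (free_ca (free_ca S)) (free_ca S) :=
  eval_mor (@comp GS _ _ _ eta h).
pose mu : CircuitAlgebraMor (free_ca (free_ca S)) (free_ca S) :=
  eval_mor (idm (free_ca S : GS)).
have h_mu (X : finType) (q : elts (free_ca (free_ca S)) X) :
    map_elts h (map_elts mu q) = map_elts h (map_elts Th q).
  exact/esym/(congr1 (fun t : @hom GS (free_ca (free_ca S)) S =>
                ntc t (Fin X) q) (alg_mul d)).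
(* On a generator [G a], [mu] returns [a] and [Th] returns [eta (h a)]. Applying [h_mu] to an
   operation on generators therefore gives each congruence condition for descent. *)
pose G := gen_nat (free_ca S).
have muG (X : finType) (a : elts (free_ca S) X) :
    map_elts mu (map_elts G a) = a by exact: (map_eltsK (eval_gen_nat _)).
have muGc (c : colours (free_ca S)) :
    map_colours mu (map_colours G c) = c by [].
have ThG (X : finType) (a : elts (free_ca S) X) :
    map_elts Th (map_elts G a) = map_elts eta (map_elts h a).
  exact (congr1 (fun t : @hom GS (free_ca S) (free_ca S) => ntc t (Fin X) a)
           (eval_gen_nat (@comp GS _ _ _ eta h))).
have ThGc (c : colours (free_ca S)) :
    map_colours Th (map_colours G c) = map_colours eta (map_colours h c) by [].
have h_prd (X Y : finType) (a : elts (free_ca S) X) (b : elts (free_ca S) Y) :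
  map_elts h (prd (nca_prd (free_ca S)) a b) =
  map_elts h (prd (nca_prd (free_ca S)) (map_elts eta (map_elts h a))
                                        (map_elts eta (map_elts h b))).
  by rewrite -{1}(muG _ a) -{1}(muG _ b) -ca_mor_prd h_mu ca_mor_prd !ThG.
have h_ctr (X : finType) (x y : X) (xy : x != y) (a : elts (free_ca S) X)
    (ac : is_contractible x y a) :
  map_elts h (ctr (nca_ctr (free_ca S)) xy (exist _ a ac)) =
  map_elts h (ctr (nca_ctr (free_ca S)) xy
    (exist _ (map_elts eta (map_elts h a))
       (contractible_map eta (contractible_map h ac)))).
  transitivity (map_elts h (map_elts mu (ctr (nca_ctr (free_ca (free_ca S))) xy
    (exist _ (map_elts G a) (contractible_map G ac))))).
    by rewrite ca_mor_ctr; congr map_elts; apply: ctr_eq; exact/esym/muG.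
  rewrite h_mu ca_mor_ctr; congr map_elts; apply: ctr_eq; exact: ThG.
have h_unit (c : colours (free_ca S)) :
  map_elts h (ca_unit (free_ca S) c) =
  map_elts h (ca_unit (free_ca S) (map_colours eta (map_colours h c))).
  by rewrite -{1}(muGc c) -ca_mor_unit h_mu ca_mor_unit ThGc.
pose B := desc_ca h_eta h_prd h_ctr.
(* The action that the comparison functor puts on [B] is the original [h]: both are morphisms of
   circuit algebras extending the identity of [S]. *)
have hB : eval_nat (A := B) (idm S) = h.
  have := @free_ca_uniq S B (eval_mor (A := B) (idm S))
            (desc_mor h_eta h_prd h_ctr h_unit).
  move=> /(_ _)/(congr1 (@ca_mor _ _)); apply.
  by rewrite [LHS]eval_gen_nat.
pose O := free_monad free_adjoint.
(* The species of [B] is [S] itself, so the identity is an algebra morphism in both directions. *)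
have idB : @comp GS _ _ _ (idm S) (eval_nat (A := B) (idm S)) =
           @comp GS _ _ _ h (fmap O (idm S)).
  by rewrite fmap1 comp1m compm1.
have idd : @comp GS _ _ _ (idm S) h =
           @comp GS _ _ _ (eval_nat (A := B) (idm S)) (fmap O (idm S)).
  by rewrite fmap1 comp1m compm1.
exists B.
exists (@Build_AlgebraMor GS O (comparison_obj free_adjoint B) d (idm S) idB).
exists (@Build_AlgebraMor GS O d (comparison_obj free_adjoint B) (idm S) idd).
by split; apply: alg_mor_eq; exact: comp1m.
Qed.

Theorem theorem1p1 : exists O : Monad GS, equivalent CA (EilenbergMoore O).
Proof.
exists (free_monad free_adjoint).
exact: (equivalence_ff_eso comparison_ff comparison_eso).
Qed.
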